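(* Let $k\ge 1$, let $K_k$ be the complete graph with vertex set $\{v_1,\ldots,v_k\}$, and let $\omega$ be a real weight function on its edges. Suppose there are real numbers $x_1,\ldots,x_k,y_1,\ldots,y_k$ such that $\omega(v_iv_j)=x_iy_j+x_jy_i$ for all $1\le i<j\le k$. Then $$\tau(K_k,\omega)=\phi(x_1,y_1,x_2,y_2,\ldots,x_k,y_k).$$
   Context: For a weighted graph $G$ with weight function $\omega:E(G)\to\mathbb{R}$, $\omega(T)=\prod_{e\in E(T)}\omega(e)$ and $\tau(G,\omega)=\sum_{T}\omega(T)$, the sum over all spanning trees $T$ of $G$. For every $\ell\ge 1$, $\phi$ is the function of $2\ell$ variables given by $$\phi(x_1,y_1,\ldots,x_\ell,y_\ell)=\frac{1}{XY}\left(\prod_{i=1}^\ell(x_iY+y_iX)-\sum_{i=1}^\ell x_iy_i\prod_{j\ne i}(x_jY+y_jX)\right),$$ where $X=x_1+\cdots+x_\ell$ and $Y=y_1+\cdots+y_\ell$; this expression is a polynomial in the variables, and for real arguments $\phi$ denotes the value of this polynomial. *)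

(* Defs.v *)
From HB Require Import structures.
From mathcomp Require Import all_boot all_order all_algebra.
From mathcomp Require Import ring mpoly.
From mathcomp Require classical_sets.

Set Implicit Arguments.
Unset Strict Implicit.
Unset Printing Implicit Defensive.

Import GRing.Theory.
Local Open Scope ring_scope.

Record sgraph (V : finType) := SGraph {
  adj :> rel V;
  adj_sym : ssrbool.symmetric adj;
  adj_irr : irreflexive adj
}.

Section Graphs.
Variable V : finType.

Definition complete_graph : sgraph V :=
  @SGraph V (fun u v => u != v)
    (fun u v => congr1 negb (eq_sym u v)) (fun u => congr1 negb (eqxx u)).

Definition edges (G : sgraph V) : {set {set V}} :=
  [set [set p.1; p.2] | p : V * V & G p.1 p.2].

Definition adj_of_edges (F : {set {set V}}) : rel V :=
  fun u v => (u != v) && ([set u; v] \in F).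

Lemma adj_of_edges_sym F : ssrbool.symmetric (adj_of_edges F).
Proof. by move=> u v; rewrite /adj_of_edges eq_sym setUC. Qed.

Lemma adj_of_edges_irr F : irreflexive (adj_of_edges F).
Proof. by move=> u; rewrite /adj_of_edges eqxx. Qed.

(* The spanning subgraph with edge set F (when F is a set of pairs). *)
Definition graph_of_edges (F : {set {set V}}) : sgraph V :=
  SGraph (adj_of_edges_sym F) (adj_of_edges_irr F).

Definition connected (G : sgraph V) : bool :=
  (0 < #|V|)%N && [forall u, forall v, connect G u v].

(* A cycle has at least 3 vertices; the length bound #|V| only makes the
   quantification finite, see acyclicP. *)
Definition acyclic (G : sgraph V) : bool :=
  [forall n : 'I_#|V|.+1, forall c : n.-tuple V, (2 < n)%N ==> ~~ ucycleb G c].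

Lemma acyclicP (G : sgraph V) :
  reflect (forall c : seq V, (2 < size c)%N -> ~ ucycle G c) (acyclic G).
Proof.
apply: (iffP forallP) => [acG c c_gt2 c_cyc | acG n].
  have c_lt : (size c < #|V|.+1)%N.
    by have /andP[_ /card_uniqP <-] := c_cyc; rewrite ltnS max_card.
  have /forallP/(_ (in_tuple c)) := acG (Ordinal c_lt).
  by rewrite /= c_gt2 /= => /negP; apply.
apply/forallP => c; apply/implyP => n_gt2; apply/negP => c_cyc.
by apply: (acG c) => //; rewrite size_tuple.
Qed.

Definition is_tree (G : sgraph V) : bool := connected G && acyclic G.

(* Spanning trees of G are identified with their edge sets. *)
Definition spanning_trees (G : sgraph V) : {set {set {set V}}} :=
  [set T : {set {set V}} | (T \subset edges G) && is_tree (graph_of_edges T)].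

(* Only the values of w on edges G are used. *)
Definition tau (R : comNzRingType) (G : sgraph V) (w : {set V} -> R) : R :=
  \sum_(T in spanning_trees G) \prod_(e in T) w e.

End Graphs.

Section Phi.
Variables (R : idomainType) (l : nat).

Local Notation P := {mpoly R[l + l]}.

(* x_i and y_i are the variables of index i and l + i. *)
Definition xvar (i : 'I_l) : P := 'X_(lshift l i).
Definition yvar (i : 'I_l) : P := 'X_(rshift l i).

Definition xsum : P := \sum_(i < l) xvar i.
Definition ysum : P := \sum_(i < l) yvar i.

Definition phi_numer : P :=
  \prod_(i < l) (xvar i * ysum + yvar i * xsum)
  - \sum_(i < l) xvar i * yvar i *
      \prod_(j < l | j != i) (xvar j * ysum + yvar j * xsum).

Definition phi_frac : {fraction P} :=
  1 / (tofrac xsum * tofrac ysum) * tofrac phi_numer.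

(* The polynomial equal to phi_frac in the field of rational functions; it is
   unique as tofrac is injective, and exists for l > 0 (phi_polyE). *)
Definition phi_poly : P := 
  classical_sets.xget 0 (fun p : P => tofrac p = phi_frac).

Definition phi (x y : 'I_l -> R) : R :=
  phi_poly.@[fun k => match split k with inl i => x i | inr i => y i end].

End Phi.

Section PhiWellDefined.

Lemma prod_linear_mod (A : comNzRingType) (I : Type) (f g : I -> A) (a b : A)
    (s : seq I) n : size s = n.+1 -> exists r,
  \prod_(i <- s) (f i * b + g i * a) =
  b ^+ n.+1 * \prod_(i <- s) f i + a ^+ n.+1 * \prod_(i <- s) g i + a * b * r.
Proof.
elim: s n => [//|i s IHs] n [sz_s].
case: n => [|n] in sz_s *.
  by exists 0; rewrite (size0nil sz_s) !big_seq1; ring.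
have [r Er] := IHs n sz_s.
exists (f i * a ^+ n * \prod_(j <- s) g j + g i * b ^+ n * \prod_(j <- s) f j
        + (f i * b + g i * a) * r).
by rewrite !big_cons Er !exprS; ring.
Qed.

Lemma numer_divisible (A : comNzRingType) (l : nat) (f g : 'I_l -> A)
    (a := \sum_i f i) (b := \sum_i g i) : (0 < l)%N -> exists r,
  \prod_i (f i * b + g i * a)
  - \sum_i f i * g i * \prod_(j | j != i) (f j * b + g j * a) = a * b * r.
Proof.
move=> l_gt0.
have [l_gt1|l_le1] := ltnP 1 l; last first.
  have El : l = 1%N by apply/eqP; rewrite eqn_leq l_le1.
  exists 1; rewrite /a /b; subst l.
  rewrite !big_ord1 (big_pred0 _ _ _ (fun j => _)) => [|j]; first by ring.
  by rewrite !ord1 eqxx.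
have El : l = l.-2.+2 by case: l l_gt1 {l_gt0 f g a b} => [|[]].
have [r Er] : exists r, \prod_i (f i * b + g i * a) =
    b ^+ l.-2.+2 * \prod_i f i + a ^+ l.-2.+2 * \prod_i g i + a * b * r.
  apply: prod_linear_mod; rewrite -[LHS]/(size (index_enum 'I_l)).
  by rewrite -El -[RHS]card_ord cardT enumT.
have Hs i : exists r, \prod_(j | j != i) (f j * b + g j * a) =
    b ^+ l.-2.+1 * \prod_(j | j != i) f j
    + a ^+ l.-2.+1 * \prod_(j | j != i) g j + a * b * r.
  have sz : size [seq j <- index_enum 'I_l | j != i] = l.-2.+1.
    rewrite -[RHS]/(l.-2.+2.-1) -El -[l in RHS]card_ord -(cardC1 i) cardE.
    by rewrite /enum_mem.
  have [q Eq] := prod_linear_mod f g a b sz; exists q.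
  by move: Eq; rewrite !big_filter.
have [q Eq] := fin_all_exists Hs.
exists (r - \sum_i f i * g i * q i).
have -> : \sum_i f i * g i * \prod_(j | j != i) (f j * b + g j * a) =
    b ^+ l.-2.+1 * \prod_i f i * b + a ^+ l.-2.+1 * \prod_i g i * a
    + a * b * \sum_i f i * g i * q i.
  transitivity (\sum_i (b ^+ l.-2.+1 * \prod_i f i * g i
      + a ^+ l.-2.+1 * \prod_i g i * f i + a * b * (f i * g i * q i))); last first.
    by rewrite !big_split /= -!mulr_sumr.
  apply: eq_bigr => i _; rewrite Eq.
  have -> : \prod_j f j = f i * \prod_(j | j != i) f j by rewrite (bigD1 i).
  have -> : \prod_j g j = g i * \prod_(j | j != i) g j by rewrite (bigD1 i).
  by ring.
by rewrite Er !exprS; ring.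
Qed.

Variables (R : idomainType) (l : nat).
Hypothesis l_gt0 : (0 < l)%N.

Lemma xsum_neq0 : xsum R l != 0.
Proof.
apply/eqP => /(congr1 (mcoeff U_(lshift l (Ordinal l_gt0)))).
rewrite mcoeff0 raddf_sum (bigD1 (Ordinal l_gt0)) //= big1 => [|i i_neq0].
  by rewrite addr0 mcoeffX eqxx; apply/eqP; rewrite oner_neq0.
rewrite mcoeffX eq_mnm1 /=.
by rewrite (inj_eq (@lshift_inj _ _)) (negPf i_neq0).
Qed.

Lemma ysum_neq0 : ysum R l != 0.
Proof.
apply/eqP => /(congr1 (mcoeff U_(rshift l (Ordinal l_gt0)))).
rewrite mcoeff0 raddf_sum (bigD1 (Ordinal l_gt0)) //= big1 => [|i i_neq0].
  by rewrite addr0 mcoeffX eqxx; apply/eqP; rewrite oner_neq0.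
rewrite mcoeffX eq_mnm1 /=.
by rewrite (inj_eq (@rshift_inj _ _)) (negPf i_neq0).
Qed.

Lemma phi_polyE : tofrac (phi_poly R l) = phi_frac R l.
Proof.
have [r Er] := numer_divisible (@xvar R l) (@yvar R l) l_gt0.
suff r_ok : tofrac r = phi_frac R l
  by exact: (@classical_sets.xgetI _ _ (fun p => tofrac p = phi_frac R l) r).
rewrite /phi_frac /phi_numer Er !tofracM mulrA mul1r mulVf ?mul1r //.
by rewrite mulf_neq0 ?tofrac_eq0 ?xsum_neq0 ?ysum_neq0.
Qed.

End PhiWellDefined.

(* Main.v *)
(** Spanning trees of the complete graph correspond to their parent maps towards
    a root r, and expanding the determinant of the Laplacian grounded at r row by
    row gives the same sum over parent maps: the term of a map f is weighted by
    the determinant for the graph of f, which is 1 if every vertex reaches r (only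
    the identity permutation contributes, by depth) and 0 otherwise. For weights
    x_i y_j + x_j y_i this Laplacian is a rank two perturbation of a diagonal
    matrix, so Sylvester's identity reduces its determinant to a 2 x 2 one. The
    latter computation divides by X, Y and x_i Y + y_i X, so it is done in the
    field of rational functions and then evaluated. *)
Require Import Defs.
From mathcomp Require Import all_boot all_order all_algebra.
From mathcomp Require Import reals.
From mathcomp Require Import perm ring.
From mathcomp Require Import -(notations) mpoly.

Set Implicit Arguments.
Unset Strict Implicit.
Unset Printing Implicit Defensive.

Import GRing.Theory.
Local Open Scope ring_scope.

(** * Spanning trees of the complete graph as parent maps *)

Section ParentMaps.
Variables (V : finType) (r : V).
Implicit Types (f g : {ffun V -> V}) (T : {set {set V}}).

(** The root has no parent; the convention [f r = r] makes [f] determined by its tree. *)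
Definition rooted f := (f r == r) && [forall i, fconnect f i r].

Definition parent_edges f : {set {set V}} := [set [set i; f i] | i in [set~ r]].

(** The rank [d] is the number of steps needed to reach [r]; conversely, strict descent forces every
    orbit into [r]. *)
Lemma rootedP f :
  reflect (f r = r /\ exists d : V -> nat, forall i, i != r -> (d (f i) < d i)%N)
          (rooted f).
Proof.
apply: (iffP andP) => [[/eqP fr /forallP cf]|[fr [d dP]]]; split=> //.
- have E i : exists n, iter n f i == r.
    by exists (findex f i r); rewrite iter_findex.
  exists (fun i => ex_minn (E i)) => i ir.
  case: (ex_minnP (E i)) => -[|n] /= /eqP; first by move/eqP; rewrite (negPf ir).
  rewrite -iterS iterSr => fn _; case: ex_minnP => m _ /(_ n).
  by rewrite fn eqxx ltnS; apply.
- by rewrite fr.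
- apply/forallP => i; have [n] := ubnP (d i); elim: n i => // n IHn i /ltnSE di.
  have [->|ir] := eqVneq i r; first exact: connect0.
  apply: connect_trans (fconnect1 f i) (IHn _ _).
  exact: leq_trans (dP i ir) di.
Qed.

Lemma eq_set2 (a b c d : V) :
  [set a; b] = [set c; d] -> a = c /\ b = d \/ a = d /\ b = c.
Proof.
move=> E; have := set21 a b; have := set22 a b; have := set21 c d; have := set22 c d.
rewrite E -{1 2}E !inE.
by do 4![case/orP=> /eqP ?]; subst; auto.
Qed.

Section Rooted.
Variable f : {ffun V -> V}.
Hypothesis rf : rooted f.

Lemma rooted_neq i : i != r -> f i != i.
Proof.
case/rootedP: rf => _ [d dP] ir; apply: contraTneq (dP i ir) => ->.
by rewrite ltnn.
Qed.

(** Two vertices sharing an edge would be each other's parent, so [d] would drop both ways. *)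
Lemma parent_edge_inj : {in [set~ r] &, injective (fun i => [set i; f i])}.
Proof.
case/rootedP: rf => _ [d dP] i j; rewrite !inE => ir jr /eq_set2[[]//|[ij fij]].
have := dP i ir; have := dP j jr; rewrite fij -ij => /ltn_trans H /H.
by rewrite ltnn.
Qed.

Lemma parent_edges_sub : parent_edges f \subset edges (complete_graph V).
Proof.
apply/subsetP => _ /imsetP[i ir ->]; apply/imsetP; exists (i, f i) => //.
by rewrite inE /= eq_sym rooted_neq // -in_setC1.
Qed.

Lemma parent_connected : connected (graph_of_edges (parent_edges f)).
Proof.
apply/andP; split; first by apply/card_gt0P; exists r.
set G := graph_of_edges _.
have symG : connect_sym G by apply: sym_connect_sym; apply: adj_sym.
have toR i : connect G i r.
  have [_ /forallP/(_ i)] := andP rf; apply: connect_sub => {}i _ /eqP<-.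
  have [->|ir] := eqVneq i r; first by have [/eqP-> _] := andP rf.
  apply: connect1; rewrite /= /adj_of_edges eq_sym rooted_neq //=.
  by apply/imsetP; exists i; rewrite ?inE.
apply/forallP => u; apply/forallP => v; apply: connect_trans (toR u) _.
by rewrite symG.
Qed.

(* On a cycle, both neighbours of a deepest vertex would be its parent. *)
Lemma parent_acyclic : acyclic (graph_of_edges (parent_edges f)).
Proof.
case/rootedP: (rf) => fr [d dP].
apply/acyclicP => c c_gt2 /andP[cyc uc].
have [x xc xmax] : exists2 x, x \in c & forall y, y \in c -> (d y <= d x)%N.
  case: c c_gt2 {cyc uc} => // a s _.
  by case: (@arg_maxnP _ a (mem (a :: s)) d (mem_head _ _)) => x; exists x.
have deep y : adj_of_edges (parent_edges f) x y -> y \in c -> y = f x.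
  case/andP=> xy /imsetP[i]; rewrite !inE => ir E yc.
  have [[-> //]|[xfi yi]] := eq_set2 E.
  by have := dP i ir; rewrite -xfi -yi ltnNge xmax.
have [n [s Es]] : exists n s, rot n c = x :: s.
  by have [n s Es] := rot_to xc; exists n, s.
move: cyc uc c_gt2; rewrite -(rot_cycle n) -(rot_uniq n) -(size_rot n).
have memE : rot n c =i c by exact: mem_rot.
rewrite Es /= in memE *; move: Es memE.
case: s => [|a [|b s]] Es memE //= /and3P[xa _].
rewrite rcons_path => /andP[_ zx] /and3P[_ abs _] _.
have aE : a = f x by apply: deep; rewrite // -memE !inE eqxx orbT.
have zE : last b s = f x.
  apply: deep; first by rewrite adj_of_edges_sym.
  by rewrite -memE !(in_cons x, in_cons a) mem_last !orbT.
by move: abs; rewrite aE -zE mem_last.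
Qed.

Lemma parent_edges_spanning :
  parent_edges f \in spanning_trees (complete_graph V).
Proof.
by rewrite inE parent_edges_sub /is_tree parent_connected parent_acyclic.
Qed.

End Rooted.

(** By induction on depth: the edge [[set i; f i]] of [g] gives either [g i = f i], or [g (f i) = i]
    and then, by induction, [f (f i) = i], against the descent of [d]. *)
Lemma parent_edges_inj : {in rooted &, injective parent_edges}.
Proof.
move=> f g; rewrite -!topredE /= => rf /rootedP[gr _] E; apply/ffunP.
have /rootedP[fr [d dP]] := rf.
move=> i; have [n] := ubnP (d i); elim: n i => // n IHn i /ltnSE di.
have [->|ir] := eqVneq i r; first by rewrite fr.
have : [set i; f i] \in parent_edges g.
  by rewrite -E; apply/imsetP; exists i; rewrite ?inE.
case/imsetP=> j; rewrite !inE => jr /eq_set2[[-> //]|[ij fij]].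
have dfi := dP i ir.
have ffi : f (f i) = i by rewrite (IHn (f i) (leq_trans dfi di)) fij.
have := dP (f i); rewrite ffi fij => /(_ jr).
by rewrite -fij ltnNge ltnW.
Qed.

(* Parents along shortest paths to r; minimality of the tree gives equality. *)
Lemma spanning_tree_parent T : T \in spanning_trees (complete_graph V) ->
  exists2 f, rooted f & T = parent_edges f.
Proof.
rewrite inE => /andP[/subsetP TK /andP[/andP[_ conT] acT]].
set G := graph_of_edges T in conT acT.
have E i : exists n, [exists p : n.-tuple V, path G i p && (last i p == r)].
  have /connectP[p Gp rE] := forallP (forallP conT i) r.
  by exists (size p); apply/existsP; exists (in_tuple p); rewrite Gp -rE /=.
pose d i := ex_minn (E i).
(* The guard [i != r] sits under the quantifier so that a parent can be chosen at every [i], with a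
   dummy value at [r]. *)
have P i : exists j, i != r -> G i j && (d j < d i)%N.
  have [->|ir] := eqVneq i r; first by exists r.
  rewrite {2}/d; case: ex_minnP => n /existsP[[p /= /eqP <-] /andP[]].
  case: p => [|j p] /=; first by rewrite (negPf ir).
  move=> /andP[Gij Gp] lp _; exists j => _; rewrite Gij ltnS /d /=.
  case: ex_minnP => m _; apply.
  by apply/existsP; exists (in_tuple p); rewrite Gp.
have [h hP] := fin_all_exists P.
pose f := [ffun i => if i == r then r else h i].
have fP i : i != r -> G i (f i) && (d (f i) < d i)%N.
  by move=> ir; rewrite ffunE (negPf ir) hP.
have rf : rooted f.
  apply/rootedP; split; first by rewrite ffunE eqxx.
  by exists d => i /fP/andP[].
exists f => //; have sub : parent_edges f \subset T.
  apply/subsetP => _ /imsetP[i ir ->].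
  by rewrite !inE in ir; have /andP[/andP[]] := fP i ir.
apply/eqP; rewrite eqEsubset sub andbT; apply/subsetP => e eT.
have /imsetP[[u v]] := TK _ eT; rewrite inE /= => uv eE.
(* A missing edge [[set u; v]] would close a simple path of at least two parent edges into a cycle
   of [G]. *)
apply: contraT; rewrite eE => uvF; rewrite eE in eT.
have /andP[_ /forallP/(_ u)/forallP/(_ v)/connectP[q Fq vE]] := parent_connected rf.
move: Fq vE; case/shortenP => p Fp up _ vE.
have Gp : path G u p.
  apply: sub_path Fp => a b /andP[ab abF].
  by rewrite /= /adj_of_edges ab (subsetP sub).
have := @acyclicP _ _ acT (u :: p).
case: p vE Fp up Gp => [|a [|b p]] /=.
- by move=> vu; rewrite vu eqxx in uv.
- by move=> va; rewrite /adj_of_edges -va (negPf uvF) andbF.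
- move=> vE _ up /and3P[ua ab bp] /(_ isT)[].
  apply/andP; split; last exact: up.
  rewrite /= in ua ab bp *; rewrite ua ab rcons_path bp /= -vE.
  by rewrite /adj_of_edges eq_sym uv setUC.
Qed.

Lemma tau_parent_maps (R : comNzRingType) (w : {set V} -> R) :
  tau (complete_graph V) w =
  \sum_(f | rooted f) \prod_(i | i != r) w [set i; f i].
Proof.
have -> : tau (complete_graph V) w =
    \sum_(T in parent_edges @: [set f | rooted f]) \prod_(e in T) w e.
  apply: eq_bigl => T; apply/idP/imsetP.
    by case/spanning_tree_parent => f rf ->; exists f; rewrite ?inE.
  by case=> f; rewrite inE => rf ->; exact: parent_edges_spanning.
rewrite big_imset => [|f g]; last by rewrite !inE; exact: parent_edges_inj.
apply: eq_big => [f|f]; rewrite inE // => rf.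
rewrite big_imset; last exact: parent_edge_inj.
by apply: eq_bigl => i; rewrite !inE.
Qed.

End ParentMaps.

Lemma sum_delta_mul (R : pzSemiRingType) (I : finType) (i : I) (F : I -> R) :
  \sum_j (i == j)%:R * F j = F i.
Proof.
rewrite (bigD1 i) //= eqxx mul1r big1 ?addr0 // => j.
by rewrite eq_sym => /negPf->; rewrite mul0r.
Qed.

(** * Weighted matrix-tree theorem *)

Section MatrixTree.
Variables (R : comNzRingType) (n : nat) (r : 'I_n).

(** Making row [r] a unit row has the same determinant as deleting row and column [r], and keeps the
    size [n]. On the diagonal [a i i] cancels, so a formula for [a] may be used at [i = j] too. *)
Definition grounded_laplacian (a : 'I_n -> 'I_n -> R) : 'M[R]_n :=
  \matrix_(i, j) if i == r then (i == j)%:R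
                 else (i == j)%:R * (\sum_c a i c) - a i j.

Lemma det_grounded_map_rooted (f : {ffun 'I_n -> 'I_n}) : rooted r f ->
  \det (grounded_laplacian (fun i j => (f i == j)%:R)) = 1.
Proof.
case/rootedP => fr [d dP]; set M := grounded_laplacian _.
have ME i j : M i j = (i == j)%:R - ((i != r) && (f i == j))%:R.
  rewrite mxE; case: eqVneq => _ /=; first by rewrite subr0.
  by under eq_bigr => c _ do rewrite -[_%:R]mulr1; rewrite sum_delta_mul mulr1.
rewrite /determinant (bigD1 (1%g : {perm 'I_n})) //= [X in _ + X]big1 => [|s s1].
  rewrite odd_perm1 expr0 mul1r addr0 big1 // => i _.
  rewrite perm1 ME eqxx; have [|ir] := eqVneq i r; first by rewrite subr0.
  by case: eqVneq (dP i ir) => [->|_ _]; rewrite ?ltnn ?subr0.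
have [i iN] : exists i, M i (s i) == 0; last first.
  by rewrite (bigD1 i) //= (eqP iN) mul0r mulr0.
(* Nonzero entries of row [i] lie at [i] and [f i], so a contributing [s] never raises [d]. As [s]
   preserves the sum of [d], it preserves each [d i], hence fixes each [i]. *)
apply/existsP; apply: contraR s1; rewrite negb_exists => /forallP nz.
have step i : s i = i \/ i != r /\ s i = f i.
  have := nz i; rewrite ME; case: (eqVneq i (s i)) => [<-|_]; first by left.
  case: (eqVneq i r) => _ /=; first by rewrite subr0 eqxx.
  by case: (eqVneq (f i) (s i)) => [->|_]; [right | rewrite subr0 eqxx].
have le i : (d (s i) <= d i)%N.
  by case: (step i) => [->|[ir ->]] //; apply: ltnW (dP i ir).
have [_] := leqif_sum (fun i (_ : true) => leqif_eq (le i)).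
rewrite [X in _ == X](reindex_perm s) eqxx => /esym/forallP E.
apply/eqP/permP => i; rewrite perm1.
case: (step i) => [//|[ir sf]]; have := dP i ir.
by rewrite -sf (eqP (E i)) ltnn.
Qed.

(* The vertices that do not reach r span a kernel vector. *)
Lemma det_grounded_map_unrooted (f : {ffun 'I_n -> 'I_n}) :
  f r = r -> ~~ rooted r f ->
  \det (grounded_laplacian (fun i j => (f i == j)%:R)) = 0.
Proof.
move=> fr; rewrite /rooted fr eqxx /= => /forallPn[k kr].
set M := grounded_laplacian _.
pose u : 'cV[R]_n := \col_i (~~ fconnect f i r)%:R.
have Mu : M *m u = 0.
  apply/colP => i; rewrite !mxE; have [ir|ir] := eqVneq i r.
    apply: big1 => j _; rewrite !mxE ir eqxx.
    by case: eqVneq => [<-|_]; rewrite ?connect0 ?mulr0 ?mul0r.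
  have deg1 : \sum_c (f i == c)%:R = 1 :> R.
    by under eq_bigr => c _ do rewrite -[_%:R]mulr1; rewrite sum_delta_mul.
  under eq_bigr => j _ do rewrite !mxE (negPf ir) deg1 mulr1 mulrBl.
  rewrite sumrB !sum_delta_mul.
  have -> : fconnect f i r = fconnect f (f i) r.
    apply/idP/idP; last by apply: connect_trans; apply: fconnect1.
    move=> /iter_findex; case: findex => [/eqP|m]; first by rewrite /= (negPf ir).
    by rewrite iterSr => <-; apply: fconnect_iter.
  by rewrite subrr.
(* The adjugate turns [M *m u = 0] into [\det M *: u = 0], read at [k] where [u] is 1; this works in
   any commutative ring. *)
have := congr1 (fun v : 'cV_n => v k 0) (mulmxA (\adj M) M u).
by rewrite Mu mulmx0 mul_adj_mx mul_scalar_mx !mxE kr mulr1.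
Qed.

(* Rows are linear in a, so it suffices to sum over maps i |-> f i. *)
Lemma det_grounded_laplacian (a : 'I_n -> 'I_n -> R) :
  \det (grounded_laplacian a) =
  \sum_(f : {ffun 'I_n -> 'I_n} | rooted r f) \prod_(i | i != r) a i (f i).
Proof.
(* [N i j] is row [i] of the Laplacian of a map sending [i] to [j]; [b r] vanishes off [r], which
   kills the maps with [f r != r]. *)
pose b i j := if i == r then (j == r)%:R else a i j.
pose N i j c : R := if i == r then (i == c)%:R else (i == c)%:R - (j == c)%:R.
have lapE i c : grounded_laplacian a i c = \sum_j b i j * N i j c.
  rewrite mxE /b /N; case: eqVneq => [->|_].
    by under [RHS]eq_bigr => j _ do rewrite eq_sym; rewrite sum_delta_mul.
  under [RHS]eq_bigr => j _ do rewrite mulrBr.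
  rewrite sumrB -mulr_suml mulrC; congr (_ - _).
  by under eq_bigr => j _ do rewrite eq_sym mulrC; rewrite sum_delta_mul.
transitivity (\sum_(f : {ffun 'I_n -> 'I_n}) (\prod_i b i (f i)) *
    \det (grounded_laplacian (fun i j => (f i == j)%:R))).
  rewrite /determinant.
  under eq_bigr => s _.
    under eq_bigr => i _ do rewrite lapE.
    rewrite bigA_distr_bigA big_distrr /=.
    over.
  rewrite exchange_big /=; apply: eq_bigr => f _.
  rewrite big_distrr /=; apply: eq_bigr => s _.
  rewrite big_split /= mulrCA; congr (_ * (_ * _)).
  apply: eq_bigr => i _; rewrite /N mxE; case: eqVneq => // _.
  under eq_bigr => c _ do rewrite -[_%:R]mulr1.
  by rewrite sum_delta_mul mulr1.
rewrite [RHS]big_mkcond; apply: eq_bigr => f _ /=.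
have [rf|nrf] := boolP (rooted r f).
  rewrite det_grounded_map_rooted // mulr1 (bigD1 r) //= /b eqxx.
  have /rootedP[-> _] := rf; rewrite eqxx mul1r.
  by apply: eq_bigr => i /negPf->.
have [fr|fr] := eqVneq (f r) r.
  by rewrite det_grounded_map_unrooted // mulr0.
by rewrite (bigD1 r) //= /b eqxx (negPf fr) !mul0r.
Qed.

Lemma matrix_tree (w : {set 'I_n} -> R) (a : 'I_n -> 'I_n -> R) :
    (forall i j, i != j -> w [set i; j] = a i j) ->
  tau (complete_graph 'I_n) w = \det (grounded_laplacian a).
Proof.
move=> wa; rewrite det_grounded_laplacian (tau_parent_maps r).
apply: eq_bigr => f rf; apply: eq_bigr => i ir.
by rewrite wa // eq_sym; apply: rooted_neq ir.
Qed.

End MatrixTree.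

(** * Laplacian determinant for weights of rank two *)

Lemma eq_grounded_laplacian (R : comNzRingType) (n : nat) (r : 'I_n)
    (a b : 'I_n -> 'I_n -> R) :
  (forall i j, a i j = b i j) -> grounded_laplacian r a = grounded_laplacian r b.
Proof.
move=> ab; apply/matrixP => i j; rewrite !mxE ab.
by under eq_bigr => c _ do rewrite ab.
Qed.

Lemma map_grounded_laplacian (R S : comNzRingType) (f : {rmorphism R -> S})
    (n : nat) (r : 'I_n) (a : 'I_n -> 'I_n -> R) :
  map_mx f (grounded_laplacian r a) = grounded_laplacian r (fun i j => f (a i j)).
Proof.
apply/matrixP => i j; rewrite !mxE; case: ifP => _; first by rewrite rmorph_nat.
by rewrite rmorphB rmorphM rmorph_nat rmorph_sum.
Qed.

(* Both sides are the determinant of the block matrix [1 A; B 1]. *)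
Lemma det_1subM_comm (R : comPzRingType) (m n : nat)
    (A : 'M[R]_(m, n)) (B : 'M[R]_(n, m)) :
  \det (1%:M - A *m B) = \det (1%:M - B *m A).
Proof.
have E1 : block_mx 1%:M A B 1%:M =
    block_mx 1%:M A 0 1%:M *m block_mx (1%:M - A *m B) 0 B 1%:M.
  by rewrite mulmx_block !(mul1mx, mulmx1, mul0mx, mulmx0, add0r, addr0) subrK.
have E2 : block_mx 1%:M A B 1%:M =
    block_mx 1%:M 0 B 1%:M *m block_mx 1%:M A 0 (1%:M - B *m A).
  rewrite mulmx_block !(mul1mx, mulmx1, mul0mx, mulmx0, add0r, addr0).
  by rewrite addrC subrK.
have := congr1 determinant E1; rewrite {1}E2 !det_mulmx !det_ublock !det_lblock.
by rewrite !det1 !mul1r !mulr1.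
Qed.

Lemma det_mx2 (R : comPzRingType) (A : 'M[R]_2) :
  \det A = A ord0 ord0 * A ord_max ord_max - A ord0 ord_max * A ord_max ord0.
Proof.
rewrite (expand_det_row _ ord0) !big_ord_recl big_ord0 /cofactor !det_mx11 !mxE /=.
rewrite expr0 mul1r addr0 expr1 mulN1r mulrN.
by congr (_ * _ - _ * _); congr (A _ _); apply: val_inj.
Qed.

(* With s, a, b the sums over i != r of x i y i / D i, x i ^ 2 / D i and
   y i ^ 2 / D i, the matrix is diagonal minus rank two, and its determinant is
   (1 - s) ^ 2 - a b times the product of the D i; the identities
   a Y + s X = X - x r and b X + s Y = Y - y r eliminate a and b. *)
Lemma det_grounded_laplacian_rank2 (F : fieldType) (n : nat) (r : 'I_n)
    (x y : 'I_n -> F) (X := \sum_i x i) (Y := \sum_i y i)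
    (D := fun i => x i * Y + y i * X) :
    X != 0 -> Y != 0 -> (forall i, D i != 0) ->
  \det (grounded_laplacian r (fun i j => x i * y j + y i * x j)) =
  1 / (X * Y) * (\prod_i D i - \sum_i x i * y i * \prod_(j | j != i) D j).
Proof.
move=> X0 Y0 D0.
(* [D i] is the sum of row [i] of the weights, loop included; factoring it out leaves the identity
   minus a rank two term. The zero row [r] of [A] yields the unit row of the root. *)
pose A : 'M[F]_(n, 2) :=
  \matrix_(i, c) if i == r then 0 else (if c == ord0 then x i else y i) / D i.
pose B : 'M[F]_(2, n) := \matrix_(c, j) if c == ord0 then y j else x j.
pose e : 'rV[F]_n := \row_i if i == r then 1 else D i.
have -> : grounded_laplacian r (fun i j => x i * y j + y i * x j) =
    diag_mx e *m (1%:M - A *m B).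
  apply/matrixP => i j; rewrite mul_diag_mx !mxE !big_ord_recl big_ord0 !mxE /=.
  case: (i == r); first by rewrite !mul0r !addr0 subr0 mul1r.
  rewrite big_split /= -!mulr_sumr -/X -/Y -/(D i).
  by have := D0 i; move: (D i) => t t0; field.
rewrite det_mulmx det_diag det_1subM_comm det_mx2.
pose s := \sum_(i | i != r) x i * y i / D i.
pose a := \sum_(i | i != r) x i * x i / D i.
pose b := \sum_(i | i != r) y i * y i / D i.
have BA c c' : (1%:M - B *m A) c c' = (c == c')%:R - \sum_(i | i != r)
    (if c == ord0 then y i else x i) * (if c' == ord0 then x i else y i) / D i.
  rewrite !mxE; congr (_ - _); rewrite (bigD1 r) //= !mxE eqxx mulr0 add0r.
  by apply: eq_bigr => i /negPf ir; rewrite !mxE ir mulrA.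
have -> : \prod_i e 0 i = \prod_(i | i != r) D i.
  rewrite (bigD1 r) //= mxE eqxx mul1r.
  by apply: eq_bigr => i /negPf ir; rewrite mxE ir.
have ys : \sum_(i | i != r) y i * x i / D i = s.
  by apply: eq_bigr => i _; rewrite (mulrC (y i)).
rewrite !BA /= ys -/s -/a -/b.
have Xr : X = x r + \sum_(i | i != r) x i by rewrite /X (bigD1 r).
have Yr : Y = y r + \sum_(i | i != r) y i by rewrite /Y (bigD1 r).
(* Termwise, [(x i * x i * Y + x i * y i * X) / D i = x i]. *)
have aE : a * Y + s * X = X - x r.
  rewrite {2}Xr addrAC subrr add0r !mulr_suml -big_split /=.
  apply: eq_bigr => i _; have := D0 i; rewrite {1}/D => di.
  by rewrite /D; field.
have bE : b * X + s * Y = Y - y r.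
  rewrite {2}Yr addrAC subrr add0r !mulr_suml -big_split /=.
  apply: eq_bigr => i _; have := D0 i; rewrite {1}/D => di.
  by rewrite /D; field.
have -> : \sum_i x i * y i * \prod_(j | j != i) D j =
    (\prod_(i | i != r) D i) * (x r * y r + s * D r).
  rewrite (bigD1 r) //= mulrDr [X in X + _ = _]mulrC; congr (_ + _).
  rewrite mulrCA mulr_suml; apply: eq_bigr => i ir.
  have -> : \prod_(j | j != i) D j = (\prod_j D j) / D i.
    by rewrite [X in _ = X / _](bigD1 i) //= [D i * _]mulrC mulfK.
  by rewrite [X in X / D i](bigD1 r) //=; ring.
have -> : \prod_i D i = D r * \prod_(i | i != r) D i by rewrite (bigD1 r).
move: (\prod_(i | _) _) => Q.
(* Once [a] and [b] are eliminated, both sides equal [Q * ((1 - s) * D r - x r * y r) / (X * Y)]. *)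
have aE' : a = (X - x r - s * X) / Y by rewrite -aE addrK mulfK.
have bE' : b = (Y - y r - s * Y) / X by rewrite -bE addrK mulfK.
by rewrite aE' bE' /D; field; rewrite X0 Y0.
Qed.

(** * From rational functions back to real numbers *)

Lemma xvar_ysum_neq0 (R : numDomainType) (l : nat) (i : 'I_l) :
  xvar R i * ysum R l + yvar R i * xsum R l != 0.
Proof.
(* Setting all variables to 1 gives [l + l], nonzero in characteristic 0 since [i] forces
   [l > 0]. *)
apply/eqP => /(congr1 (meval (fun=> 1))) /eqP.
have ev (j : 'I_(l + l)) : meval (fun=> 1) (mpolyX R (mnm1 j)) = 1.
  by rewrite mevalXU.
rewrite rmorph0 rmorphD !rmorphM !rmorph_sum /=.
under eq_bigr => j _ do rewrite ev.
under [X in _ + _ * X]eq_bigr => j _ do rewrite ev.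
rewrite !ev !mul1r sumr_const card_ord -natrD Num.Theory.pnatr_eq0 addn_eq0 andbb.
by case: l i {ev} => [[]|].
Qed.

(** As [tofrac] is injective, the two polynomials can be compared in the fraction field, where every
    denominator of the rank two computation is nonzero. *)
Lemma phi_poly_det (R : numDomainType) (l : nat) (r : 'I_l) :
  phi_poly R l = \det (grounded_laplacian r
    (fun i j => xvar R i * yvar R j + yvar R i * xvar R j)).
Proof.
have l_gt0 : (0 < l)%N := leq_ltn_trans (leq0n r) (ltn_ord r).
apply/eqP; rewrite -tofrac_eq phi_polyE // -det_map_mx map_grounded_laplacian.
have tofrac_weight (i j : 'I_l) :
    tofrac (xvar R i * yvar R j + yvar R i * xvar R j) =
    tofrac (xvar R i) * tofrac (yvar R j) + tofrac (yvar R i) * tofrac (xvar R j).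
  by rewrite tofracD !tofracM.
rewrite (eq_grounded_laplacian r tofrac_weight).
have xE : \sum_i tofrac (xvar R i) = tofrac (xsum R l) by rewrite -rmorph_sum.
have yE : \sum_i tofrac (yvar R i) = tofrac (ysum R l) by rewrite -rmorph_sum.
rewrite det_grounded_laplacian_rank2 ?xE ?yE ?tofrac_eq0 ?xsum_neq0 ?ysum_neq0 //;
  last by move=> i; rewrite -!tofracM -tofracD tofrac_eq0 xvar_ysum_neq0.
rewrite /phi_frac /phi_numer tofracB !rmorph_prod !rmorph_sum /=.
apply/eqP; congr (_ * (_ - _)).
  by apply: eq_bigr => i _; rewrite /= xE yE tofracD !tofracM.
apply: eq_bigr => i _; rewrite !tofracM rmorph_prod; congr (_ * _).
by apply: eq_bigr => j _; rewrite /= xE yE tofracD !tofracM.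
Qed.

Theorem theorem4p2 (R : realType) (k : nat) (k_ge1 : (1 <= k)%N)
    (w : {set 'I_k} -> R) (x y : 'I_k -> R)
    (w_xy : forall i j : 'I_k, (i < j)%N ->
      w [set i; j] = x i * y j + x j * y i) :
  tau (complete_graph 'I_k) w = phi x y.
Proof.
pose r := Ordinal k_ge1.
rewrite (@matrix_tree _ _ r _ (fun i j => x i * y j + y i * x j)); last first.
  move=> i j ij; have [ltij|] := ltnP i j; first by rewrite w_xy // [y i * _]mulrC.
  rewrite leq_eqVlt eq_sym (inj_eq val_inj) (negPf ij) /= => ltji.
  by rewrite setUC w_xy //; ring.
(* Evaluation is a ring morphism, so it commutes with the determinant even where [x] and [y] make
   the denominators of [phi_frac] vanish. *)
rewrite /phi (phi_poly_det _ r) -det_map_mx map_grounded_laplacian.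
congr (\det _); apply: eq_grounded_laplacian => i j.
rewrite rmorphD !rmorphM /= !mevalXU.
by rewrite !(unsplitK (inl _)) !(unsplitK (inr _)).
Qed.
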